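(* Let $X=X_\Sigma$ be a smooth projective toric variety, let $x$ be a primitive ray generator of $\Sigma$, let $p\ge2$ be an integer, and put $\widehat X=H(x,p)(X)$, with new ray generators $z_1,\dots,z_p$ replacing $x$. Let $\mathrm G(\Sigma)$ be the set of primitive ray generators of $\Sigma$; for $v\in\mathrm G(\Sigma)$ let $D_v$ be the corresponding invariant prime divisor on $X$, for $v\in\mathrm G(\Sigma)\setminus\{x\}$ let $\widehat D_v$ be the corresponding invariant prime divisor on $\widehat X$, and let $D_{z_i}$ be the invariant prime divisor on $\widehat X$ corresponding to $z_i$. There is a natural lattice isomorphism $$\Phi_x:\mathrm{Pic}(X)\xrightarrow{\ \sim\ }\mathrm{Pic}(\widehat X)$$ such that $\Phi_x([D_v])=[\widehat D_v]$ for $v\in \mathrm G(\Sigma)\setminus\{x\}$, $\Phi_x([D_x])=[D_{z_1}]=\cdots=[D_{z_p}]$, and $$\Phi_x(\mathrm{Nef}(X)\cap\mathrm{Pic}(X))=\mathrm{Nef}(\widehat X)\cap\mathrm{Pic}(\widehat X).$$ Moreover, $$\Phi_x^{-1}(-K_{\widehat X})=-K_X+(p-1)[D_x].$$ Consequently, whenever $\widehat X$ is weak Fano, $$\tau_{\widehat X}(\mathbb K)=\tau_X(-K_X+(p-1)[D_x];\mathbb K)\qquad(\mathbb K\in\{\mathbb Z,\mathbb Q\}).$$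
   Context: All toric varieties are over an algebraically closed field. Gongyo indices. For a smooth projective toric variety $X$, a nonzero class $D\in\mathrm{Nef}(X)\cap\mathrm{Pic}(X)$ and $\mathbb K\in\{\mathbb Z,\mathbb Q\}$, put $$\tau_X(D;\mathbb K)=\sup\Big\{\sum_{i=1}^r a_i\ \Big|\ D=\sum_{i=1}^r a_iD_i,\ 0\ne D_i\in\mathrm{Nef}(X)\cap\mathrm{Pic}(X),\ a_i\in\mathbb K_{>0}\Big\}$$ (for $\mathbb K=\mathbb Q$ the equality is in $\mathrm{Pic}(X)\otimes\mathbb Q$). If $-K_X$ is nef and nonzero, $\tau_X(\mathbb K):=\tau_X(-K_X;\mathbb K)$. A primitive collection of a smooth complete fan is a set of primitive ray generators that does not span a cone although every proper subset does; a set of ray generators spans a cone iff it contains no primitive collection. The construction $H(x,p)$. Let $X=X_\Sigma$ be a smooth projective toric variety with lattice $N$, $x$ a primitive ray generator of $\Sigma$ and $p\ge2$. In $\widehat N=N\oplus\mathbb Z^{p-1}$ let $z_1,\dots,z_{p-1}$ be the standard basis of the second summand and $z_p:=x-z_1-\cdots-z_{p-1}$. $H(x,p)(X)=X_{\widehat\Sigma}$ is the smooth projective toric variety of dimension $\dim X+p-1$ whose fan $\widehat\Sigma$ in $\widehat N$ has primitive ray generators $(\mathrm G(\Sigma)\setminus\{x\})\cup\{z_1,\dots,z_p\}$ and primitive collections exactly the primitive collections $P$ of $\Sigma$ with $x\notin P$, together with $(P\setminus\{x\})\cup\{z_1,\dots,z_p\}$ for the primitive collections $P\ni x$ of $\Sigma$.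 *)

(* Defs.v *)
From HB Require Import structures.
From mathcomp Require Import all_boot all_order all_algebra.
From mathcomp Require Import ring_quotient.
From mathcomp Require Import boolp classical_sets reals constructive_ereal ereal.

Set Implicit Arguments.
Unset Strict Implicit.
Unset Printing Implicit Defensive.

Import Order.TTheory GRing.Theory Num.Theory.
Local Open Scope ring_scope.
Local Open Scope quotient_scope.

(* A toric variety is represented by its fan, in the lattice N = Z^n of row
   vectors; M is the lattice of column vectors.  All cones are simplicial, so
   a cone is given by the set of (indices of) its primitive ray generators.
   None of the notions below depends on the base field. *)
Record toric (n : nat) := Toric {
  rays : finType;
  ray : rays -> 'rV[int]_n;
  cones : {set {set rays}}
}.
Arguments ray {n} t v.
Arguments cones {n} t.

(* Membership in the cone spanned by the generators in S, tested on N_Q: the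
   cones are rational, hence determined by their points in N_Q. *)
Definition in_cone n (X : toric n) (S : {set rays X}) (w : 'rV[rat]_n) : Prop :=
  exists c : rays X -> rat,
    (forall v, 0 <= c v) /\ w = \sum_(v in S) c v *: map_mx intr (ray X v).

Definition part_of_basis n (X : toric n) (S : {set rays X}) : Prop :=
  exists (B : 'M[int]_n) (f : rays X -> 'I_n),
    [/\ B \in unitmx, {in S &, injective f}
      & forall v, v \in S -> row (f v) B = ray X v].

Record smooth_complete n (X : toric n) : Prop := SmoothComplete {
  cone0 : finset.set0 \in cones X;
  cone_face : forall S T : {set rays X},
    S \subset T -> T \in cones X -> S \in cones X;
  cone_ray : forall v, [set v]%SET \in cones X;
  cone_smooth : forall S, S \in cones X -> part_of_basis S;
  cone_meet : forall S T, S \in cones X -> T \in cones X ->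
    forall w, in_cone S w -> in_cone T w -> in_cone (S :&: T) w;
  cone_complete : forall w, exists2 S, S \in cones X & in_cone S w
}.

(* Torus-invariant divisors; D v is the multiplicity of D_v. *)
Definition divisor n (X : toric n) := {ffun rays X -> int}.

Definition div_char n (X : toric n) (m : 'cV[int]_n) : divisor X :=
  [ffun v => (ray X v *m m) 0 0].

Definition principal n (X : toric n) : {pred divisor X} :=
  [pred D | `[< exists m, D = div_char X m >]].

Arguments principal {n} X.

Lemma principal_zmod_closed n (X : toric n) : zmod_closed (principal X).
Proof.
split.
  apply/asboolP; exists 0; apply/ffunP => v.
  by rewrite !ffunE mulmx0 mxE.
move=> D E /asboolP[m ->] /asboolP[m' ->]; apply/asboolP; exists (m - m').
by apply/ffunP => v; rewrite !ffunE mulmxBr !mxE.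
Qed.

HB.instance Definition _ n (X : toric n) :=
  GRing.isZmodClosed.Build (divisor X) (principal X)
    (@principal_zmod_closed n X).

(* Pic(X) = Z^{G(Sigma)} / M. *)
Definition Pic n (X : toric n) := Quotient.quot (principal X).

Definition cls n (X : toric n) (D : divisor X) : Pic X :=
  \pi_(Quotient.quot (principal X)) D.

Definition prime_div n (X : toric n) (v : rays X) : divisor X :=
  [ffun w => (w == v)%:R].

(* [D_v] *)
Definition dcl n (X : toric n) (v : rays X) : Pic X := cls (prime_div v).

(* K_X = - \sum_v D_v *)
Definition canonical_class n (X : toric n) : Pic X := - \sum_(v : rays X) dcl v.
Arguments canonical_class {n} X.

(* The complete torus-invariant curves are the orbit closures V(tau) of the
   walls tau, the (n-1)-dimensional cones.  Such a wall is a facet of exactly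
   two maximal cones tau + v and tau + v', and smoothness gives the wall
   relation  v + v' + \sum_(r in tau) b_r r = 0  with integers b_r. *)
Record invariant_curve n (X : toric n) := InvariantCurve {
  wall : {set rays X};
  side1 : rays X;
  side2 : rays X;
  wcoef : rays X -> int;
  wall_dim : #|wall|.+1 = n;
  side_neq : side1 != side2;
  side1_notin : side1 \notin wall;
  side2_notin : side2 \notin wall;
  side1_cone : (side1 |: wall)%SET \in cones X;
  side2_cone : (side2 |: wall)%SET \in cones X;
  wall_relation :
    ray X side1 + ray X side2 + \sum_(r in wall) wcoef r *: ray X r = 0
}.

(* The intersection number D . V(tau): V(tau) meets D_v and D_v' with
   multiplicity 1, D_r with multiplicity b_r for r in tau, and no other D_w. *)
Definition inter n (X : toric n) (D : divisor X) (C : invariant_curve X) : int :=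
  D (side1 C) + D (side2 C) + \sum_(r in wall C) wcoef C r * D r.

(* On a complete toric variety the invariant curves generate the cone of
   curves, so they test nefness, and ampleness by Kleiman's criterion. *)
Definition Nef n (X : toric n) : set (Pic X) :=
  [set cls D | D in [set D : divisor X | forall C, 0 <= inter D C]]%classic.
Arguments Nef {n} X.

Definition Ample n (X : toric n) : set (Pic X) :=
  [set cls D | D in [set D : divisor X | forall C, 0 < inter D C]]%classic.
Arguments Ample {n} X.

Definition smooth_projective n (X : toric n) : Prop :=
  smooth_complete X /\ exists D, Ample X D.

Definition effective n (X : toric n) : set (Pic X) :=
  [set cls D | D in [set D : divisor X | forall v, 0 <= D v]]%classic.
Arguments effective {n} X.

(* Big: some positive multiple is ample plus effective. *)
Definition Big n (X : toric n) : set (Pic X) :=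
  [set D | exists (k : nat) (A E : Pic X),
    [/\ (0 < k)%N, Ample X A, effective X E & D *+ k = A + E]]%classic.
Arguments Big {n} X.

Definition weak_fano n (X : toric n) : Prop :=
  Nef X (- canonical_class X) /\ Big X (- canonical_class X).

(* Equality  D (x) 1 = \sum_i D_i (x) a_i  in A (x) Q, which is the
   localization of A at the positive integers: the two sides agree in A after
   multiplication by some common denominator N of the a_i. *)
Definition eq_tensorQ (A : zmodType) r (D : A) (a : 'I_r -> rat)
    (E : 'I_r -> A) : Prop :=
  exists (N : nat) (b : 'I_r -> int),
    [/\ (0 < N)%N, forall i, (b i)%:~R = N%:R * a i
      & D *+ N = \sum_(i < r) E i *~ b i].

Definition sums_Z (R : realType) n (X : toric n) (D : Pic X) : set (\bar R) :=
  [set s | exists r (a : 'I_r -> int) (E : 'I_r -> Pic X),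
    [/\ forall i, 0 < a i, forall i, E i != 0, forall i, Nef X (E i),
        D = \sum_(i < r) E i *~ a i
      & s = ((\sum_(i < r) a i)%:~R)%:E]]%classic.
Arguments sums_Z R {n X} D.

Definition sums_Q (R : realType) n (X : toric n) (D : Pic X) : set (\bar R) :=
  [set s | exists r (a : 'I_r -> rat) (E : 'I_r -> Pic X),
    [/\ forall i, 0 < a i, forall i, E i != 0, forall i, Nef X (E i),
        eq_tensorQ D a E
      & s = (ratr (\sum_(i < r) a i))%:E]]%classic.
Arguments sums_Q R {n X} D.

Variant coeff := coeffZ | coeffQ.

(* tau_X(D; K); meant for D nef and nonzero. *)
Definition tau (R : realType) n (X : toric n) (D : Pic X) (K : coeff) : \bar R :=
  ereal_sup (match K with coeffZ => sums_Z R D | coeffQ => sums_Q R D end).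
Arguments tau R {n X} D K.

Definition gongyo (R : realType) n (X : toric n) (K : coeff) : \bar R :=
  tau R (- canonical_class X) K.
Arguments gongyo R {n} X K.

Definition primitive_collections n (X : toric n) : {set {set rays X}} :=
  [set P : {set rays X} | (P \notin cones X) &&
    [forall Q : {set rays X}, (Q \proper P) ==> (Q \in cones X)]]%SET.
Arguments primitive_collections {n} X.

Section Construction.
Variables (n : nat) (X : toric n) (x : rays X) (p : nat).

(* (G(Sigma) \ {x}) together with z_1, ..., z_p *)
Definition Hrays : finType := ({v : rays X | v != x} + 'I_p)%type.

(* inr i stands for z_(i+1): the vectors z_1, ..., z_(p-1) form the standard
   basis of Z^(p-1), and z_p = x - z_1 - ... - z_(p-1). *)
Definition Hray (v : Hrays) : 'rV[int]_(n + p.-1) :=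
  match v with
  | inl w => row_mx (ray X (val w)) 0
  | inr i =>
      if (i < p.-1)%N then row_mx 0 (\row_(j < p.-1) (i == j :> nat)%:R)
      else row_mx (ray X x) (const_mx (-1))
  end.

(* P if x is not in P, and (P \ {x}) together with z_1, ..., z_p otherwise. *)
Definition Hlift (P : {set rays X}) : {set Hrays} :=
  [set v : Hrays | match v with inl w => val w \in P | inr _ => x \in P end]%SET.

(* A set of generators spans a cone iff it contains no primitive collection. *)
Definition Hcones : {set {set Hrays}} :=
  [set S : {set Hrays} |
    [forall P in primitive_collections X, ~~ (Hlift P \subset S)]]%SET.

Definition H : toric (n + p.-1) := Toric Hray Hcones.

Definition Hold (v : rays X) (hv : v != x) : rays H := inl (exist _ v hv).

Definition Hz (i : 'I_p) : rays H := inr i.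

End Construction.

Arguments H {n} X x p.
Arguments Hold {n X x} p {v} hv.
Arguments Hz {n X} x {p} i.

Lemma Hlift_subset n (X : toric n) (x : rays X) p (P Q : {set rays X}) :
  (0 < p)%N -> (Hlift x p P \subset Hlift x p Q) = (P \subset Q).
Proof.
move=> p0; apply/fintype.subsetP/fintype.subsetP => [s v vP|s [w|i]].
- have [vx|hv] := eqVneq v x.
    by have := s (inr (Ordinal p0)); rewrite !inE -vx; exact.
  by have := s (inl (exist _ v hv)); rewrite !inE; exact.
- by rewrite !inE; exact: s.
- by rewrite !inE; exact: s.
Qed.

Lemma primitive_collections_H n (X : toric n) (x : rays X) p :
  (0 < p)%N ->
  primitive_collections (H X x p) =
    [set Hlift x p P | P in primitive_collections X]%SET.
Proof.
move=> p0; apply/setP => S; rewrite [LHS]inE; apply/andP/imsetP => [[]|[P PX ->]].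
  rewrite inE negb_forall => /existsP[P]; rewrite negb_imply negbK.
  case/andP=> PX sPS /forallP/(_ (Hlift x p P)) hS; exists P => //.
  apply/eqP; rewrite eq_sym eqEproper sPS /=; apply/negP => prP.
  move/implyP: hS => /(_ prP); rewrite inE => /forallP/(_ P).
  by rewrite PX subxx.
split.
  rewrite inE negb_forall; apply/existsP; exists P.
  by rewrite negb_imply negbK PX subxx.
apply/forallP => T; apply/implyP => prT; rewrite inE.
apply/forall_inP => Q QX; apply/negP => sQT.
have := sub_proper_trans sQT prT; rewrite properE !Hlift_subset // -properE.
move=> prQ; move: PX; rewrite inE => /andP[_ /forallP/(_ Q)]; rewrite prQ /=.
by move: QX; rewrite inE => /andP[/negbTE ->].
Qed.

(* Main.v *)
From HB Require Import structures.
Require Import Defs.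
From mathcomp Require Import all_boot all_order all_algebra.
From mathcomp Require Import boolp classical_sets reals constructive_ereal ereal.
From mathcomp Require Import ring_quotient zify ring.
Import mathcomp.boot.fintype mathcomp.boot.finset.
Import Order.TTheory GRing.Theory Num.Theory.
Local Open Scope ring_scope.

Set Implicit Arguments.
Unset Strict Implicit.
Unset Printing Implicit Defensive.

(** Everything is governed by the map [collapse] from the rays of H(x, p)(X) to
    those of X that sends every z_i to x and fixes the other rays.  The rays in
    the fibre over v add up to (v, 0): over x this is z_1 + ... + z_p = x.
    Consequently the linear relations among the new rays are exactly the
    pullbacks along [collapse] of the relations among the old ones
    ([lift_relation], [relation_collapse]).  Dually, summing multiplicities over
    the fibres of [collapse] turns divisors on H(x, p)(X) into divisors on X
    and induces Pic(H(x, p)(X)) = Pic(X); this is the inverse of Phi_x.  As each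
    D_{z_i} is sent to D_x and there are p of them, the formula for the
    anticanonical class follows.

    An invariant curve acts on divisors through the coefficients of its wall
    relation ([inter_relation]), so curves on both sides can be compared through
    relations.  Every curve of X lifts to a curve with the pulled back relation
    ([lift_curve]); hence a nef divisor on H(x, p)(X) gives a nef one on X.

    The converse is where geometry enters, because some curves of H(x, p)(X),
    those whose two sides are both among the z_i, have a relation that need not
    be the relation of any curve of X.  For a wall with a side a, the generators
    v whose whole fibre lies in wall + a form a maximal cone S of X.  Let m be
    the linear function that agrees with the divisor D on S.  A relation kills
    linear functions, so the intersection number is the sum of c_v (D_v - m(v)),
    and only generators v outside S contribute; for these the coefficient c_v is
    0 or 1, since some ray over v is not in the wall.  So it suffices that
    m(v) <= D_v for all v, that is, that the support function of a nef divisor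
    is globally convex ([nef_support_le]).

    Nefness only gives convexity across walls.  To globalize it at a generator v,
    walk through maximal cones: as long as the current cone S does not contain v,
    some coordinate of v in the basis S is negative, and crossing the opposite
    facet does not decrease m(v) if D is nef.  For an ample divisor the
    corresponding value strictly increases, so the walk terminates, and it can
    only end in a cone containing v, where m(v) = D_v.  This is the one use of
    projectivity.  That each facet of a maximal cone has another cone on its
    other side ([adjacent_cone]) comes from completeness of the fan.

    Finally, an isomorphism of Picard groups matching the nef cones transports
    decompositions into nonzero nef classes, hence the invariants tau. *)

(** * Pairing of N with M *)

Definition pairing n (w : 'rV[int]_n) (m : 'cV[int]_n) : int := (w *m m) 0 0.

Section Pairing.
Variables (n : nat).
Implicit Types (v w : 'rV[int]_n) (m : 'cV[int]_n).

Lemma pairingZl k w m : pairing (k *: w) m = k * pairing w m.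
Proof. by rewrite /pairing -scalemxAl mxE. Qed.

Lemma pairingDl v w m : pairing (v + w) m = pairing v m + pairing w m.
Proof. by rewrite /pairing mulmxDl mxE. Qed.

Lemma pairingNl w m : pairing (- w) m = - pairing w m.
Proof. by rewrite /pairing mulNmx mxE. Qed.

Lemma pairing0l m : pairing 0 m = 0.
Proof. by rewrite /pairing mul0mx mxE. Qed.

Lemma pairing_suml (I : finType) (P : pred I) (F : I -> 'rV[int]_n) m :
  pairing (\sum_(i | P i) F i) m = \sum_(i | P i) pairing (F i) m.
Proof. by rewrite /pairing mulmx_suml summxE. Qed.

Lemma pairing_combl (I : finType) (P : pred I) (c : I -> int)
    (F : I -> 'rV[int]_n) m :
  pairing (\sum_(i | P i) c i *: F i) m = \sum_(i | P i) c i * pairing (F i) m.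
Proof. by rewrite pairing_suml; apply: eq_bigr => i _; rewrite pairingZl. Qed.

End Pairing.

(** * Integral points of cones *)

(** Because the cones are smooth, an integral point of a cone is a combination
    of the generators with integral coefficients.  Working with these alone
    keeps all later computations in the integers. *)
Definition coneZ n (X : toric n) (S : {set rays X}) (w : 'rV[int]_n) : Prop :=
  exists c : rays X -> int,
    (forall v, 0 <= c v) /\ w = \sum_(v in S) c v *: ray X v.

Section Cones.
Variables (n : nat) (X : toric n).
Hypothesis hX : smooth_complete X.
Implicit Types (S T : {set rays X}) (u v : rays X) (w : 'rV[int]_n).

(** The generators of a smooth cone are part of a basis, so a linear function can
    be prescribed on them. *)
Lemma cone_interpolation S (D : rays X -> int) : S \in cones X ->
  exists m, forall v, v \in S -> pairing (ray X v) m = D v.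
Proof.
move=> /(cone_smooth hX)[B [f [uB finj fB]]].
exists (invmx B *m \col_i \sum_(v in S | f v == i) D v) => v vS.
rewrite /pairing mulmxA -(fB v vS) -row_mul mulmxV // row1 -rowE !mxE.
rewrite (big_pred1 v) // => w /=; apply/andP/eqP => [[wS /eqP e]|->].
  exact: (finj w v wS vS e).
by rewrite vS eqxx.
Qed.

Lemma dual_functional S v : S \in cones X -> v \in S ->
  exists m, forall u, u \in S -> pairing (ray X u) m = (u == v)%:R.
Proof. by move=> SX vS; exact: (cone_interpolation (fun u => (u == v)%:R)). Qed.

Lemma dual_basis S : S \in cones X -> exists h : rays X -> 'cV[int]_n,
  forall v, v \in S -> forall u, u \in S -> pairing (ray X u) (h v) = (u == v)%:R.
Proof.
move=> SX; suff /choice : forall v, exists m : 'cV[int]_n, v \in S ->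
    forall u, u \in S -> pairing (ray X u) m = (u == v)%:R.
  by case=> h hP; exists h.
move=> v; have [vS|//] := boolP (v \in S); last by exists 0.
by have [m mP] := dual_functional SX vS; exists m.
Qed.

Lemma pairing_dual S v m (c : rays X -> int) : v \in S ->
  (forall u, u \in S -> pairing (ray X u) m = (u == v)%:R) ->
  pairing (\sum_(u in S) c u *: ray X u) m = c v.
Proof.
move=> vS hm; rewrite pairing_combl (bigD1 v) //= hm // eqxx mulr1.
by rewrite big1 ?addr0 // => u /andP[uS /negbTE uv]; rewrite hm // uv mulr0.
Qed.

Lemma pairing_comb0 S T v m (c : rays X -> int) : v \notin T -> T \subset S ->
  (forall u, u \in S -> pairing (ray X u) m = (u == v)%:R) ->
  pairing (\sum_(u in T) c u *: ray X u) m = 0.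
Proof.
move=> vT /subsetP TS hm; rewrite pairing_combl big1 // => u uT.
rewrite hm ?TS //; case: eqVneq => [e|_]; last by rewrite mulr0.
by rewrite -e uT in vT.
Qed.

Lemma card_cone S : S \in cones X -> (#|S| <= n)%N.
Proof.
move=> /(cone_smooth hX)[B [f [_ finj _]]].
by rewrite -(card_in_imset finj) -[leqRHS]card_ord max_card.
Qed.

Lemma maximal_cone_span S w : S \in cones X -> #|S| = n ->
  exists c : rays X -> int, w = \sum_(v in S) c v *: ray X v.
Proof.
move=> /(cone_smooth hX)[B [f [uB finj fB]]] cS.
exists (fun v => (w *m invmx B) 0 (f v)).
rewrite -[LHS](mulmxKV uB) [LHS]mulmx_sum_row.
have fT : f @: S = setT.
  by apply/eqP; rewrite eqEcard subsetT cardsT card_ord card_in_imset //= cS.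
have -> : \sum_i (w *m invmx B) 0 i *: row i B =
          \sum_(i in f @: S) (w *m invmx B) 0 i *: row i B.
  by apply: eq_bigl => i; rewrite fT in_setT.
by rewrite big_imset //=; apply: eq_bigr => v vS; rewrite fB.
Qed.

Lemma coneZ_in_cone S w : coneZ S w -> in_cone S (map_mx intr w).
Proof.
case=> c [c0 ->]; exists (fun v => (c v)%:~R); split=> [v|]; first by rewrite ler0z.
by rewrite raddf_sum; apply: eq_bigr => v _ /=; rewrite map_mxZ.
Qed.

(** The coefficients are recovered by the dual functionals, which are integral
    on N. *)
Lemma in_cone_coneZ S w : S \in cones X -> in_cone S (map_mx intr w) -> coneZ S w.
Proof.
move=> SX [c [c0 wE]].
have [h hP] := dual_basis SX.
have cE v : v \in S -> c v = (pairing w (h v))%:~R.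
  move=> vS; rewrite /pairing.
  have := congr1 (fun t : 'rV_n => (t *m map_mx intr (h v)) 0 0) wE.
  rewrite /= -map_mxM mxE => ->.
  rewrite mulmx_suml summxE (bigD1 v) //= -scalemxAl mxE -map_mxM mxE.
  rewrite -/(pairing _ _) hP // eqxx mulr1 big1 ?addr0 // => u /andP[uS /negbTE uv].
  by rewrite -scalemxAl mxE -map_mxM mxE -/(pairing _ _) hP // uv mulr0.
exists (fun v => if v \in S then pairing w (h v) else 0); split=> [v|].
  by case: ifP => // vS; rewrite -(ler0z rat) -cE.
have map_inj : injective (map_mx intr : 'rV[int]_n -> 'rV[rat]_n).
  by move=> t t' /rowP e; apply/rowP => j; have := e j; rewrite !mxE => /intr_inj.
apply: map_inj; rewrite wE raddf_sum; apply: eq_bigr => v vS /=.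
by rewrite vS map_mxZ cE.
Qed.

Lemma coneZ_meet S T w : S \in cones X -> T \in cones X ->
  coneZ S w -> coneZ T w -> coneZ (S :&: T) w.
Proof.
move=> SX TX /coneZ_in_cone wS /coneZ_in_cone wT; apply: in_cone_coneZ.
  by apply: (cone_face hX) SX; apply: subsetIl.
exact: (cone_meet hX).
Qed.

Lemma coneZ_complete w : exists2 S, S \in cones X & coneZ S w.
Proof.
have [S SX wS] := cone_complete hX (map_mx intr w).
by exists S => //; apply: in_cone_coneZ.
Qed.

(** * Crossing a facet of a maximal cone *)

(** There are finitely many cones, so one of them captures points of any
    sequence arbitrarily far out. *)
Lemma cofinal_cone (w : nat -> 'rV[int]_n) : exists2 T, T \in cones X &
  forall K, exists2 k, (K <= k)%N & coneZ T (w k).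
Proof.
apply: contrapT => nT.
have /choice[K hK] : forall T : {set rays X}, exists K : nat, T \in cones X ->
    forall k, (K <= k)%N -> ~ coneZ T (w k).
  move=> T; apply: contrapT => nK; apply: nT; exists T.
    by apply: contrapT => nTX; apply: nK; exists 0%N => /nTX.
  move=> K; apply: contrapT => nk; apply: nK; exists K => TX k Kk wk.
  by apply: nk; exists k.
have [T TX wT] := coneZ_complete (w (\max_T K T)).
exact: (hK T TX _ (leq_bigmax T) wT).
Qed.

(** A cone is closed, so it contains the direction of a half-line that keeps
    meeting it.  The coordinates of u are those of k u + t up to a bounded error,
    hence nonnegative; that u lies in the linear span is seen on the difference
    of two of these points. *)
Lemma coneZ_direction T (u t : 'rV[int]_n) : T \in cones X ->
  (forall K, exists2 k, (K <= k)%N & coneZ T (u *+ k + t)) -> coneZ T u.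
Proof.
move=> TX Tinf.
have wm k m : pairing (u *+ k + t) m = pairing u m *+ k + pairing t m.
  by rewrite pairingDl -scaler_nat pairingZl mulr_natl.
have u_ge0 m : (forall k, coneZ T (u *+ k + t) -> 0 <= pairing (u *+ k + t) m) ->
    0 <= pairing u m.
  move=> hm; have [k Kk /hm] := Tinf `|pairing t m|.+1%N.
  by rewrite wm; move: Kk; nia.
have [k1 _ [c1 [c1_ge0 e1]]] := Tinf 0%N.
have [k2 lt12 [c2 [c2_ge0 e2]]] := Tinf k1.+1.
have [h hP] := dual_basis TX.
exists (fun v => if v \in T then pairing u (h v) else 0); split=> [v|].
  case: ifP => // vT; apply: u_ge0 => k [c [c_ge0 ->]].
  by rewrite (pairing_dual c vT (hP v vT)).
have k_neq0 : (k2%:Z - k1%:Z) != 0 by rewrite subr_eq0; lia.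
have scale_inj (y y' : 'rV[int]_n) :
    (k2%:Z - k1%:Z) *: y = (k2%:Z - k1%:Z) *: y' -> y = y'.
  move=> /rowP e; apply/rowP => j; have := e j; rewrite !mxE.
  exact: (mulfI k_neq0).
apply: scale_inj.
have -> : (k2%:Z - k1%:Z) *: u = (u *+ k2 + t) - (u *+ k1 + t).
  by rewrite scalerBl opprD addrACA subrr addr0 -!scaler_nat !natz.
rewrite scaler_sumr e1 e2 -sumrB; apply: eq_bigr => v vT.
rewrite vT -scalerBl scalerA; congr (_ *: _).
have := wm k1 (h v); have := wm k2 (h v).
rewrite e1 e2 !(pairing_dual _ vT (hP v vT)) => -> ->.
by ring.
Qed.

(** With u the sum of the generators of the facet W opposite to r, the points
    k u - r approach the interior of W from the side away from S.  A cone T that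
    contains them for arbitrarily large k contains u, hence W, but not r, and it
    is larger than W. *)
Lemma adjacent_cone S r : S \in cones X -> r \in S ->
  exists2 r', r' \notin S & r' |: (S :\ r) \in cones X.
Proof.
move=> SX rS; set W := S :\ r.
have WS : W \subset S by exact: subsetDl.
have rW : r \notin W by rewrite !inE eqxx.
pose u := \sum_(s in W) ray X s.
have uE : u = \sum_(s in W) (1 : int) *: ray X s.
  by apply: eq_bigr => s _; rewrite scale1r.
have [T TX Tinf] := cofinal_cone (fun k => u *+ k - ray X r).
have uT : coneZ T u := coneZ_direction TX Tinf.
have WT : W \subset T.
  apply/subsetP => s sW.
  have sS : s \in S by move/subsetP: WS; exact.
  have [m mP] := dual_functional SX sS.
  have uS : coneZ S u.
    exists (fun v => (v \in W)%:R); split=> [v|]; first by rewrite ler0n.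
    rewrite (bigID (mem W)) /= [X in _ + X]big1 ?addr0 => [|v /andP[_ /negbTE ->]].
      apply: eq_big => v; last by move=> vW; rewrite vW scale1r.
      by apply/idP/andP => [vW|[]//]; split=> //; move/subsetP: WS; exact.
    by rewrite scale0r.
  have [c [_ uTS]] := coneZ_meet TX SX uT uS.
  apply: contraT => sT.
  have : pairing u m = 0.
    rewrite uTS; apply: (pairing_comb0 _ _ _ mP); last exact: subsetIr.
    by rewrite !inE (negbTE sT).
  rewrite uE (pairing_dual (fun=> 1) sW) // => v vW; apply: mP.
  by move/subsetP: WS; exact.
have [k _ [c [c_ge0 wk]]] := Tinf 0%N.
have wm m : pairing (u *+ k - ray X r) m = pairing u m *+ k - pairing (ray X r) m.
  by rewrite pairingDl pairingNl -scaler_nat pairingZl mulr_natl.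
have rT : r \notin T.
  apply/negP => rT.
  have [m mP] := dual_functional TX rT.
  have := wm m; rewrite {1}wk (pairing_dual _ rT mP) mP // eqxx.
  rewrite uE (pairing_comb0 _ rW WT mP) mul0rn.
  by have := c_ge0 r; lia.
have [r' r'T r'W] : exists2 r', r' \in T & r' \notin W.
  apply/subsetPn/negP => TW.
  have [m mP] := dual_functional SX rS.
  have := wm m; rewrite {1}wk mP // eqxx uE.
  rewrite !(pairing_comb0 _ _ _ mP) ?(subset_trans TW) //.
  by rewrite mul0rn.
exists r'; last by apply: (cone_face hX) TX; rewrite subUset sub1set r'T.
have : r' != r by apply: contraNneq rT => <-.
by apply: contraNN => r'S; move: r'W; rewrite !inE r'S andbT negbK.
Qed.

(** The coordinate of r' along r is a unit because both cones are smooth; it is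
    -1 because otherwise the two cones would overlap off their common facet. *)
Lemma adjacent_relation S r r' : S \in cones X -> #|S| = n -> r \in S ->
  r' \notin S -> r' |: (S :\ r) \in cones X ->
  exists b : rays X -> int,
    ray X r + ray X r' + \sum_(s in S :\ r) b s *: ray X s = 0.
Proof.
move=> SX cS rS r'S; set W := S :\ r => S'X.
have WS : W \subset S by exact: subsetDl.
have rW : r \notin W by rewrite !inE eqxx.
have r'W : r' \notin W by rewrite !inE negb_and r'S orbT.
have [d r'E] := maximal_cone_span (ray X r') SX cS.
have r'E2 : ray X r' = d r *: ray X r + \sum_(s in W) d s *: ray X s.
  rewrite r'E (bigD1 r) //=; congr (_ + _); apply: eq_bigl => s.
  by rewrite !inE andbC.
have dr_unit : exists e, d r * e = 1.
  have [m mP] := dual_functional S'X (setU11 r' W).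
  exists (pairing (ray X r) m).
  have := congr1 (fun t => pairing t m) r'E2; rewrite /= pairingDl pairingZl.
  rewrite mP ?setU11 // eqxx (pairing_comb0 _ r'W (subsetUr _ _) mP) addr0.
  by [].
have dr_lt0 : d r < 0.
  rewrite ltNge; apply/negP => dr_ge0.
  (* a point of both cones whose coordinate along r is d r *)
  pose t := ray X r' + \sum_(s in W) `|d s| *: ray X s.
  have tS' : coneZ (r' |: W) t.
    exists (fun s => if s == r' then 1 else `|d s|); split=> [v|].
      by case: ifP.
    rewrite big_setU1 //= eqxx scale1r; congr (_ + _).
    by apply: eq_bigr => s sW; case: eqVneq => // e; rewrite -e sW in r'W.
  have tS : coneZ S t.
    exists (fun s => if s == r then d r else `|d s| + d s); split=> [v|].
      by case: ifP => // _; rewrite -[X in _ + X]opprK subr_ge0 -normrN ler_norm.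
    rewrite (bigD1 r) //= eqxx /t r'E2 -addrA; congr (_ + _).
    rewrite -big_split /=; apply: eq_big => s; first by rewrite !inE andbC.
    rewrite !inE => /andP[/negbTE -> _].
    by rewrite addrC -scalerDl.
  have [c' [_ tE]] := coneZ_meet SX S'X tS tS'.
  have [m mP] := dual_functional SX rS.
  have : pairing t m = 0.
    rewrite tE (pairing_comb0 _ _ _ mP) ?subsetIl // !inE rS eqxx /= orbF.
    by apply: contraNneq r'S => <-.
  rewrite /t r'E2 !pairingDl pairingZl mP // eqxx !(pairing_comb0 _ rW WS mP).
  by rewrite mulr1 !addr0 => dr0; case: dr_unit => e; rewrite dr0 mul0r.
exists (fun s => - d s).
rewrite r'E2; have -> : d r = -1.
  case: dr_unit => e /(congr1 absz)/eqP; rewrite abszM muln_eq1.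
  by case/andP=> /eqP dr1 _; rewrite -[d r]opprK -(ltr0_norm dr_lt0) -abszE dr1.
rewrite scaleN1r addrA subrr add0r -big_split /= big1 // => s _.
by rewrite scaleNr subrr.
Qed.

Lemma facet_curve S r : S \in cones X -> #|S| = n -> r \in S ->
  exists C : invariant_curve X,
    [/\ side1 C = r, wall C = S :\ r & #|side2 C |: wall C| = n].
Proof.
move=> SX cS rS; have [r' r'S S'X] := adjacent_cone SX rS.
have [b rel] := adjacent_relation SX cS rS r'S S'X.
have cW : #|S :\ r|.+1 = n by move: cS; rewrite (cardsD1 r S) rS.
have rr' : r != r' by apply: contraNneq r'S => <-.
have rW : r \notin S :\ r by rewrite !inE eqxx.
have r'W : r' \notin S :\ r by rewrite !inE negb_and r'S orbT.
have SX1 : r |: (S :\ r) \in cones X by rewrite setD1K.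
exists (InvariantCurve cW rr' rW r'W SX1 S'X rel); split=> //=.
by rewrite cardsU1 r'W.
Qed.

(** * Global convexity of nef support functions *)

(** Crossing the facet of T opposite to r changes the value at x of the linear
    function of E by - d_r (E . C), where d_r is the coordinate of x along r.
    If d_r < 0, this is nonnegative for E = D nef and positive for E = A ample.
    So among the cones whose D-value at x is at least that of S, one with maximal
    A-value has all d_r >= 0 and therefore contains x. *)
Lemma nef_support_le (D A : divisor X) (S : {set rays X}) (x : rays X) m :
  (forall C, 0 <= inter D C) -> (forall C, 0 < inter A C) ->
  S \in cones X -> #|S| = n ->
  (forall v, v \in S -> pairing (ray X v) m = D v) ->
  pairing (ray X x) m <= D x.
Proof.
move=> nefD ampA SX cS mP.
have lin (E : divisor X) : exists h : {set rays X} -> 'cV[int]_n,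
    forall T, T \in cones X -> forall v, v \in T -> pairing (ray X v) (h T) = E v.
  suff /choice : forall T, exists m : 'cV[int]_n, T \in cones X ->
      forall v, v \in T -> pairing (ray X v) m = E v.
    by case=> h hP; exists h.
  move=> T; have [TX|//] := boolP (T \in cones X); last by exists 0.
  by have [m' m'P] := cone_interpolation E TX; exists m'.
have [hD hDP] := lin D; have [hA hAP] := lin A.
have [c cE] := maximal_cone_span (ray X x) SX cS.
have hSx : pairing (ray X x) (hD S) = pairing (ray X x) m.
  rewrite cE !pairing_combl; apply: eq_bigr => v vS.
  by rewrite mP // hDP.
pose P T := [&& T \in cones X, #|T| == n
  & pairing (ray X x) (hD S) <= pairing (ray X x) (hD T)].
have PS : P S by rewrite /P SX cS eqxx lexx.
have [T /and3P[TX /eqP cT leT] maxT] :=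
  Order.TotalTheory.arg_maxP (fun T => pairing (ray X x) (hA T)) PS.
have [d dE] := maximal_cone_span (ray X x) TX cT.
have cross (E : divisor X) h (C : invariant_curve X) r :
    (forall T, T \in cones X -> forall v, v \in T -> pairing (ray X v) (h T) = E v) ->
    r \in T -> side1 C = r -> wall C = T :\ r ->
    pairing (ray X x) (h (side2 C |: wall C)) =
      pairing (ray X x) (h T) - d r * inter E C.
  move=> hP rT eC1 eW; set T' := _ |: _.
  have T'X : T' \in cones X := side2_cone C.
  have TE s : s \in wall C -> pairing (ray X s) (h T') = E s.
    by move=> sW; rewrite hP // inE sW orbT.
  have rel := congr1 (fun t => pairing t (h T')) (wall_relation C).
  move: rel; rewrite /= !pairingDl pairing0l pairing_combl eC1.
  rewrite (hP _ T'X (side2 C)) ?setU11 // => rel.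
  have rE : pairing (ray X r) (h T') = E r - inter E C.
    move: rel; rewrite /inter eC1.
    under eq_bigr => s sW do rewrite TE //.
    move/eqP; rewrite -addrA addr_eq0 => /eqP ->.
    by rewrite -addrA [in RHS]opprD addNKr.
  rewrite dE !pairing_combl (bigD1 r) //= [X in _ = X - _](bigD1 r) //= rE (hP T) //.
  rewrite mulrBr addrAC; congr (_ + _ - _); apply: eq_bigr => s /andP[sT sr].
  by rewrite (hP T) // TE // eW !inE sr.
have d_ge0 r : r \in T -> 0 <= d r.
  move=> rT; rewrite leNgt; apply/negP => dr0.
  have [C [eC1 eW cT']] := facet_curve TX cT rT.
  have /maxT : P (side2 C |: wall C).
    rewrite /P (side2_cone C) cT' eqxx (cross D hD C r) //=.
    by apply: (le_trans leT); rewrite lerDl oppr_ge0; have := nefD C; nia.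
  rewrite /= (cross A hA C r) // gerDl oppr_le0.
  by have := ampA C; nia.
(* x lies in the cone over T, and a ray meets T only if it is one of its rays *)
have xT : x \in T.
  apply: contraT => xT.
  have xxT : coneZ T (ray X x).
    exists (fun v => if v \in T then d v else 0); split=> [v|].
      by case: ifP => // /d_ge0.
    by rewrite dE; apply: eq_bigr => v ->.
  have xx : coneZ [set x] (ray X x).
    exists (fun=> 1); split=> [v|]; first exact: ler01.
    by rewrite big_set1 scale1r.
  have [e [_ xE]] := coneZ_meet (cone_ray hX x) TX xx xxT.
  have [m' m'P] := dual_functional (cone_ray hX x) (set11 x).
  have := m'P x (set11 x); rewrite eqxx xE.
  rewrite (pairing_comb0 _ _ _ m'P) ?subsetIl //.
  by rewrite inE (negbTE xT) andbF.
by rewrite -hSx (le_trans leT) // (hDP T).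
Qed.

End Cones.

(** * Curves as linear relations *)

Section CurveRelations.
Variables (n : nat) (X : toric n).

Definition curve_relation (C : invariant_curve X) (v : rays X) : int :=
  if v \in wall C then wcoef C v else ((v == side1 C) || (v == side2 C))%:R.

Lemma sum_wall_support (V : zmodType) (W : {set rays X}) (a b : rays X)
    (F : rays X -> V) :
  a != b -> a \notin W -> b \notin W ->
  (forall v, v \notin W -> v != a -> v != b -> F v = 0) ->
  \sum_v F v = F a + F b + \sum_(v in W) F v.
Proof.
move=> ab aW bW F0; rewrite (bigID (mem W)) /= addrC; congr (_ + _).
rewrite (bigD1 a) //= (bigD1 b) /= ?bW 1?eq_sym // big1 ?addr0 // => v.
by case/andP=> /andP[vW va] vb; exact: F0.
Qed.

Lemma curve_relation_side1 C : curve_relation C (side1 C) = 1.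
Proof. by rewrite /curve_relation (negbTE (side1_notin C)) eqxx. Qed.

Lemma curve_relation_side2 C : curve_relation C (side2 C) = 1.
Proof. by rewrite /curve_relation (negbTE (side2_notin C)) eqxx orbT. Qed.

Lemma curve_relation0 C v :
  v \notin wall C -> v != side1 C -> v != side2 C -> curve_relation C v = 0.
Proof.
by move=> vW v1 v2; rewrite /curve_relation (negbTE vW) (negbTE v1) (negbTE v2).
Qed.

Lemma curve_relation_ge0 C v : v \notin wall C -> 0 <= curve_relation C v.
Proof. by rewrite /curve_relation => /negbTE ->; rewrite ler0n. Qed.

Lemma inter_relation (D : divisor X) C :
  inter D C = \sum_v curve_relation C v * D v.
Proof.
rewrite (@sum_wall_support _ (wall C) (side1 C) (side2 C)) ?side_neq
  ?side1_notin ?side2_notin //; last first.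
  by move=> v vW v1 v2; rewrite curve_relation0 // mul0r.
rewrite curve_relation_side1 curve_relation_side2 !mul1r; congr (_ + _).
by apply: eq_bigr => v vW; rewrite /curve_relation vW.
Qed.

Lemma curve_relation_rays C : \sum_v curve_relation C v *: ray X v = 0.
Proof.
rewrite (@sum_wall_support _ (wall C) (side1 C) (side2 C)) ?side_neq
  ?side1_notin ?side2_notin //; last first.
  by move=> v vW v1 v2; rewrite curve_relation0 // scale0r.
rewrite curve_relation_side1 curve_relation_side2 !scale1r.
rewrite -[RHS](wall_relation C); congr (_ + _).
by apply: eq_bigr => v vW; rewrite /curve_relation vW.
Qed.

Lemma curve_of_relation (c : rays X -> int) (W : {set rays X}) (a b : rays X) :
  #|W|.+1 = n -> a != b -> a \notin W -> b \notin W ->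
  a |: W \in cones X -> b |: W \in cones X ->
  c a = 1 -> c b = 1 ->
  (forall v, v \notin W -> v != a -> v != b -> c v = 0) ->
  \sum_v c v *: ray X v = 0 ->
  exists C : invariant_curve X,
    forall D : divisor X, inter D C = \sum_v c v * D v.
Proof.
move=> cW ab aW bW aX bX ca cb c0 rel.
have rel' : ray X a + ray X b + \sum_(v in W) c v *: ray X v = 0.
  rewrite -[RHS]rel (@sum_wall_support _ W a b) ?ca ?cb ?scale1r //.
  by move=> v vW va vb; rewrite c0 // scale0r.
exists (InvariantCurve cW ab aW bW aX bX rel') => D.
rewrite /inter /= (@sum_wall_support _ W a b) ?ca ?cb ?mul1r //.
by move=> v vW va vb; rewrite c0 // mul0r.
Qed.

End CurveRelations.

(** * The class map *)

Section Classes.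
Variables (n : nat) (X : toric n).

Lemma clsP (D E : divisor X) :
  (exists m, D - E = div_char X m) <-> cls D = cls E.
Proof.
split=> [/asboolP e|/eqP]; first by apply/eqP; rewrite -Quotient.idealrBE.
by rewrite -Quotient.idealrBE => /asboolP.
Qed.

Lemma cls_repr (E : Pic X) : cls (generic_quotient.repr E) = E.
Proof. exact: generic_quotient.reprK. Qed.

Lemma cls_zmod_morphism : zmod_morphism (@cls n X).
Proof. by move=> D E; rewrite /cls raddfB. Qed.

HB.instance Definition _ :=
  GRing.isZmodMorphism.Build (divisor X) (Pic X) (@cls n X) cls_zmod_morphism.

End Classes.

(** * Relations among the rays of H(x, p)(X) *)

Section HConstruction.
Variables (n : nat) (X : toric n) (x : rays X) (q : nat).

(* p = q + 1, so the second summand of the lattice is Z^q *)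
Local Notation XH := (H X x q.+1).

Definition collapse (u : rays XH) : rays X :=
  match u with inl w => val w | inr _ => x end.

(** The choice of z_p over x is arbitrary: the classes of all z_i agree. *)
Definition section (v : rays X) : rays XH :=
  if insub v is Some w then inl w else inr ord_max.

Lemma section_x : section x = inr ord_max.
Proof. by rewrite /section insubF // eqxx. Qed.

Lemma section_old w : section (val w) = inl w.
Proof. by rewrite /section valK. Qed.

Lemma sectionK : cancel section collapse.
Proof.
move=> v; rewrite /section; case: insubP => [w _ <- //|].
by rewrite negbK => /eqP ->.
Qed.

Lemma fiber_sum_old (V : zmodType) (F : rays XH -> V) v : v != x ->
  \sum_(u | collapse u == v) F u = F (section v).
Proof.
move=> vx; apply: big_pred1 => u /=; apply/eqP/eqP => [e|->]; last exact: sectionK.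
move: vx; rewrite -e; case: u {e} => [w|i]; first by rewrite section_old.
by rewrite eqxx.
Qed.

Lemma fiber_sum_new (V : zmodType) (F : rays XH -> V) :
  \sum_(u | collapse u == x) F u = \sum_(i < q.+1) F (inr i).
Proof.
rewrite big_sumType /= big_pred0 ?add0r => [|w]; last exact/negbTE/(valP w).
by apply: eq_bigl => i; rewrite eqxx.
Qed.

Lemma ray_last : ray XH (inr ord_max) = row_mx (ray X x) (const_mx (-1)).
Proof. by rewrite /= ltnn. Qed.

Lemma ray_new (i : 'I_q) :
  ray XH (inr (widen_ord (leqnSn q) i)) = row_mx 0 (delta_mx 0 i).
Proof.
rewrite /= ltn_ord; congr row_mx; apply/rowP => j.
by rewrite !mxE eqxx /= eq_sym.
Qed.

(** Over x, the -1 entries of z_p cancel the basis vectors z_1, ..., z_(p-1). *)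
Lemma fiber_sum_ray v :
  \sum_(u | collapse u == v) ray XH u = row_mx (ray X v) 0.
Proof.
have [->|vx] := eqVneq v x; last first.
  by rewrite fiber_sum_old // /section insubT.
rewrite fiber_sum_new big_ord_recr ray_last.
under eq_bigr => i _ do rewrite ray_new.
have -> : \sum_(i < q) row_mx (0 : 'rV[int]_n) (delta_mx 0 i) =
    row_mx (0 : 'rV[int]_n) (\sum_(i < q) delta_mx 0 i).
  elim/big_rec2: _ => [|i A B _ ->]; first by rewrite row_mx0.
  by rewrite add_row_mx addr0.
rewrite [LHS]add_row_mx add0r; congr row_mx; apply/rowP => j.
rewrite !mxE summxE (bigD1 j) //= mxE !eqxx big1 ?addr0 ?subrr // => i ij.
by rewrite mxE eqxx /= eq_sym (negbTE ij).
Qed.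

Lemma sum_collapse (V : zmodType) (F : rays XH -> V) :
  \sum_u F u = \sum_v \sum_(u | collapse u == v) F u.
Proof. exact: partition_big. Qed.

Lemma lift_relation (c : rays X -> int) :
  \sum_u c (collapse u) *: ray XH u = row_mx (\sum_v c v *: ray X v) 0.
Proof.
rewrite sum_collapse.
have -> : row_mx (\sum_v c v *: ray X v) 0 =
    \sum_v c v *: row_mx (ray X v) (0 : 'rV[int]_q).
  elim/big_rec2: _ => [|v A B _ <-]; first by rewrite row_mx0.
  by rewrite scale_row_mx scaler0 add_row_mx addr0.
apply: eq_bigr => v _; rewrite -fiber_sum_ray scaler_sumr.
by apply: eq_bigr => u /eqP ->.
Qed.

(** The j-th coordinate of the second summand is 1 on z_j, -1 on z_p and 0 on
    every other ray, so it forces the coefficients of z_j and z_p to agree. *)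
Lemma relation_collapse (c : rays XH -> int) :
  \sum_u c u *: ray XH u = 0 -> forall u, c u = c (section (collapse u)).
Proof.
move=> rel [w|i] /=; first by rewrite section_old.
rewrite section_x; have [iq|qi] := ltnP i q; last first.
  by congr (c (inr _)); apply/val_inj/eqP; rewrite /= eqn_leq qi -ltnS ltn_ord.
pose j := Ordinal iq.
have -> : i = widen_ord (leqnSn q) j by exact: val_inj.
pose m : 'cV[int]_(n + q) := col_mx 0 (delta_mx j 0).
have := congr1 (fun t => pairing t m) rel.
rewrite pairing_combl pairing0l big_sumType big1 => [|w _]; last first.
  by rewrite /pairing mul_row_col mulmx0 mul0mx addr0 mxE mulr0.
rewrite big_ord_recr ray_last [LHS]add0r.
under eq_bigr => k _ do rewrite ray_new.
rewrite (bigD1 j) //= big1 ?addr0 => [|k kj]; last first.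
  rewrite /pairing mul_row_col mulmx0 add0r mul_delta_mx_cond mulrb.
  by rewrite (negbTE kj) mxE mulr0.
rewrite /pairing !mul_row_col !mulmx0 !add0r mul_delta_mx mxE !eqxx mulr1.
rewrite -colE !mxE mulrN1 => /eqP.
by rewrite subr_eq0 => /eqP.
Qed.

Lemma relation_descends (c : rays XH -> int) :
  \sum_u c u *: ray XH u = 0 ->
  \sum_v c (section v) *: ray X v = 0.
Proof.
move=> rel; have := lift_relation (fun v => c (section v)).
under eq_bigr => u _ do rewrite -(relation_collapse rel).
rewrite rel => /(congr1 (@lsubmx _ 1 n q)).
by rewrite row_mxKl linear0 => <-.
Qed.

(** * The isomorphism of Picard groups *)

Definition push_div (D : divisor XH) : divisor X :=
  [ffun v => \sum_(u | collapse u == v) D u].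

(** Pulling back along [collapse] would multiply the class over x by p; putting
    the whole multiplicity on one ray of each fibre gives a right inverse of
    [push_div]. *)
Definition lift_div (D : divisor X) : divisor XH :=
  [ffun u => if u == section (collapse u) then D (collapse u) else 0].

Lemma lift_divK : cancel lift_div push_div.
Proof.
move=> D; apply/ffunP => v; rewrite ffunE (bigD1 (section v)) /= ?sectionK //.
rewrite ffunE sectionK eqxx big1 ?addr0 // => u /andP[/eqP <- us].
by rewrite ffunE (negbTE us).
Qed.

Lemma push_div_zmod_morphism : zmod_morphism push_div.
Proof.
move=> D E; apply/ffunP => v; rewrite !ffunE -sumrB.
by apply: eq_bigr => u _; rewrite !ffunE.
Qed.

Lemma lift_div_zmod_morphism : zmod_morphism lift_div.
Proof. by move=> D E; apply/ffunP => v; rewrite !ffunE; case: ifP; rewrite ?subr0. Qed.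

Lemma sum_push_div (c : rays X -> int) (D : divisor XH) :
  \sum_v c v * push_div D v = \sum_u c (collapse u) * D u.
Proof.
rewrite [RHS]sum_collapse; apply: eq_bigr => v _; rewrite ffunE mulr_sumr.
by apply: eq_bigr => u /eqP ->.
Qed.

Lemma push_div_char m : push_div (div_char XH m) = div_char X (@usubmx _ n q 1 m).
Proof.
apply/ffunP => v; rewrite !ffunE.
under eq_bigr => u _ do rewrite ffunE -/(pairing _ _).
rewrite -pairing_suml fiber_sum_ray /pairing -[in LHS](@vsubmxK _ n q 1 m).
by rewrite mul_row_col mul0mx addr0.
Qed.

Lemma lift_div_char m : lift_div (div_char X m) = div_char XH (col_mx m 0).
Proof.
apply/ffunP => -[w|i]; rewrite !ffunE /=.
  by rewrite section_old eqxx mul_row_col mul0mx addr0.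
rewrite section_x; case: ifP => [/eqP[->]|].
  by rewrite ltnn mul_row_col mulmx0 addr0.
case: ifP => [_ _|]; first by rewrite mul_row_col mulmx0 addr0 mul0mx mxE.
move=> iq /eqP[]; congr inr; apply/val_inj/eqP.
by rewrite /= eqn_leq -ltnS ltn_ord leqNgt iq.
Qed.

(** Modulo the coordinates of the second summand, whose divisors are
    D_{z_j} - D_{z_p}, all multiplicities can be moved from the z_j to z_p. *)
Lemma push_divK (D : divisor XH) : cls (lift_div (push_div D)) = cls D.
Proof.
apply/esym/clsP.
pose m : 'cV[int]_q := \col_j D (inr (widen_ord (leqnSn q) j)).
exists (col_mx 0 m); apply/ffunP => -[w|i]; rewrite !ffunE /=.
  rewrite section_old eqxx mul_row_col mul0mx addr0 mulmx0 mxE.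
  by rewrite fiber_sum_old ?(valP w) // section_old subrr.
rewrite section_x; have [->|im] := eqVneq i ord_max.
  rewrite eqxx ltnn mul_row_col mulmx0 add0r fiber_sum_new big_ord_recr /=.
  rewrite opprD addrC addrNK mxE -sumrN; apply: eq_bigr => j _.
  by rewrite !mxE mulN1r.
have iq : (i < q)%N.
  by rewrite ltn_neqAle -ltnS ltn_ord andbT; apply: contra im => /eqP e; exact/eqP/val_inj.
have -> : (inr i == inr ord_max :> rays XH) = false by apply/eqP => -[e]; rewrite e eqxx in im.
have -> : i = widen_ord (leqnSn q) (Ordinal iq) by exact: val_inj.
rewrite -[X in (X *m _) 0 0]/(ray XH (inr (widen_ord (leqnSn q) (Ordinal iq)))).
rewrite ray_new mul_row_col mulmx0 add0r subr0.
by rewrite -rowE !mxE.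
Qed.

Definition Pic_lift (E : Pic X) : Pic XH := cls (lift_div (generic_quotient.repr E)).

Definition Pic_push (E : Pic XH) : Pic X := cls (push_div (generic_quotient.repr E)).

Lemma Pic_lift_cls D : Pic_lift (cls D) = cls (lift_div D).
Proof.
have /clsP[m e] := cls_repr (cls D).
apply/clsP; exists (col_mx m 0 : 'cV_(n + q)).
by rewrite -lift_div_zmod_morphism e lift_div_char.
Qed.

Lemma Pic_push_cls D : Pic_push (cls D) = cls (push_div D).
Proof.
have /clsP[m e] := cls_repr (cls D).
apply/clsP; exists (@usubmx _ n q 1 m).
by rewrite -push_div_zmod_morphism e push_div_char.
Qed.

Lemma Pic_liftK : cancel Pic_lift Pic_push.
Proof. by move=> E; rewrite -(cls_repr E) Pic_lift_cls Pic_push_cls lift_divK. Qed.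

Lemma Pic_pushK : cancel Pic_push Pic_lift.
Proof. by move=> E; rewrite -(cls_repr E) Pic_push_cls Pic_lift_cls push_divK. Qed.

Lemma Pic_lift_zmod_morphism : zmod_morphism Pic_lift.
Proof.
move=> D E; rewrite -(cls_repr D) -(cls_repr E) -raddfB !Pic_lift_cls.
by rewrite lift_div_zmod_morphism raddfB.
Qed.

HB.instance Definition _ :=
  GRing.isZmodMorphism.Build (Pic X) (Pic XH) Pic_lift Pic_lift_zmod_morphism.

HB.instance Definition _ :=
  GRing.isZmodMorphism.Build (Pic XH) (Pic X) Pic_push
    (can2_zmod_morphism Pic_liftK Pic_pushK).

Lemma push_prime_div u : push_div (prime_div u) = prime_div (collapse u).
Proof.
apply/ffunP => v; rewrite !ffunE; case: (eqVneq v (collapse u)) => [->|vu].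
  rewrite (bigD1 u) //= ffunE eqxx big1 ?addr0 // => w /andP[_ /negbTE wu].
  by rewrite ffunE wu.
rewrite big1 // => w /eqP e; rewrite ffunE.
by case: eqP => // wu; rewrite -e wu eqxx in vu.
Qed.

Lemma Pic_lift_dcl u : Pic_lift (dcl (collapse u)) = dcl u.
Proof. by rewrite /dcl -push_prime_div -Pic_push_cls Pic_pushK. Qed.

Lemma Pic_push_anticanonical :
  Pic_push (- canonical_class XH) = - canonical_class X + dcl x *+ q.
Proof.
apply: (can_inj Pic_liftK); rewrite Pic_pushK /canonical_class !opprK.
rewrite raddfD raddfMn raddf_sum /= sum_collapse (bigD1 x) //=.
rewrite [in RHS](bigD1 x) //= addrAC; congr (_ + _).
  rewrite fiber_sum_new; under eq_bigr => i _ do rewrite -Pic_lift_dcl /=.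
  by rewrite sumr_const card_ord mulrS.
apply: eq_bigr => v vx; rewrite fiber_sum_old //.
by rewrite -[RHS]/(Pic_lift _) -[v in RHS]sectionK Pic_lift_dcl.
Qed.

(** * Cones of H(x, p)(X) *)

Implicit Types (S : {set rays XH}) (P : {set rays X}) (u : rays XH).

(** The largest set of old generators whose preimage under [collapse] lies in S;
    the function [Hlift] is the preimage, see [Hlift_sub_saturated]. *)
Definition saturated (S : {set rays XH}) : {set rays X} :=
  [set v | [forall u : rays XH, (collapse u == v) ==> (u \in S)]]%SET.

Lemma saturatedP S v :
  reflect (forall u, collapse u = v -> u \in S) (v \in saturated S).
Proof.
rewrite inE; apply: (iffP forallP) => [h u e|h u].
  by move: (h u); rewrite e eqxx.
by apply/implyP => /eqP; exact: h.
Qed.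

Lemma Hlift_sub_saturated P S : (Hlift x q.+1 P \subset S) = (P \subset saturated S).
Proof.
have HP u : (u \in Hlift x q.+1 P) = (collapse u \in P) by rewrite inE; case: u.
apply/subsetP/subsetP => h.
  by move=> v vP; apply/saturatedP => u e; apply: h; rewrite HP e.
by move=> u; rewrite HP => /h /saturatedP; exact.
Qed.

(** A set that spans no cone contains a minimal one, a primitive collection. *)
Lemma conesH S : smooth_complete X -> (S \in cones XH) = (saturated S \in cones X).
Proof.
move=> hX; rewrite inE; apply/forall_inP/idP => [noP|SX P PX].
  apply: contraT => sX.
  have [P Pmin PS] := minset_exists (P := fun T => T \notin cones X) sX.
  case/minsetP: Pmin => PX Pmin.
  have /noP : P \in primitive_collections X.
    rewrite inE PX; apply/forallP => Q; apply/implyP => QP; apply: contraT => QX.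
    have e := Pmin Q QX (proper_sub QP).
    by move: QP; rewrite e properxx.
  by rewrite Hlift_sub_saturated PS.
rewrite Hlift_sub_saturated; apply/negP => PS.
by move: PX; rewrite inE (cone_face hX PS SX).
Qed.

Definition new_rays : {set rays XH} := [set inr i | i in 'I_q.+1]%SET.

Lemma card_new_rays : #|new_rays| = q.+1.
Proof. by rewrite card_imset ?card_ord // => i j []. Qed.

(** S consists of a choice of one ray over each element of [saturated S] and of
    at most p - 1 further z_i: if all z_i are in S, one of them is the chosen one
    over x.  So maximal cones of H(x, p)(X) lie over maximal cones of X. *)
Lemma card_saturated S : (#|S| <= #|saturated S| + q)%N.
Proof.
have old_in (w : {v | v != x}) : inl w \in S -> inl w \in section @: saturated S.
  move=> wS; rewrite -section_old; apply: imset_f; apply/saturatedP.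
  case=> [w' /val_inj -> //|i /= e].
  by case/negP: (valP w); apply/eqP/esym.
suff [Z SZ cZ] : exists2 Z : {set rays XH},
    S \subset section @: saturated S :|: Z & (#|Z| <= q)%N.
  apply: (leq_trans (subset_leq_card SZ)); apply: (leq_trans (leq_card_setU _ _)).
  by apply: leq_add cZ; exact: leq_imset_card.
have [xS|xS] := boolP (x \in saturated S).
  exists (new_rays :\ section x).
    apply/subsetP => -[w|i] uS; rewrite in_setU ?old_in //.
    rewrite in_setD1 imset_f // andbT; case: eqVneq => [->|_]; last by rewrite orbT.
    by rewrite imset_f.
  have := card_new_rays; rewrite (cardsD1 (section x)).
  by rewrite section_x imset_f // add1n => -[->].
exists (new_rays :&: S).
  by apply/subsetP => -[w|i] uS; rewrite in_setU ?old_in // in_setI uS imset_f ?orbT.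
suff: (#|new_rays :&: S| < #|new_rays|)%N by rewrite card_new_rays ltnS.
apply: proper_card; rewrite properE subsetIl.
apply: contraNN xS => /subsetP ZS; apply/saturatedP => -[w /= e|i _].
  by case/negP: (valP w); apply/eqP.
by have := ZS (inr i); rewrite imset_f // in_setI => /(_ isT)/andP[].
Qed.

(** * Comparison of nef classes *)

Lemma nef_of_push (D : divisor XH) : smooth_projective X ->
  (forall C, 0 <= inter (push_div D) C) -> forall C, 0 <= inter D C.
Proof.
move=> [hX [_ [A ampA _]]] nefD C.
pose S := side1 C |: wall C.
have SX : saturated S \in cones X by rewrite -conesH // side1_cone.
have cS : #|saturated S| = n.
  apply/eqP; rewrite eqn_leq (card_cone hX SX) /= -(leq_add2r q).
  apply: leq_trans (card_saturated S).
  by rewrite cardsU1 side1_notin add1n (wall_dim C).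
have [m mP] := cone_interpolation hX (push_div D) SX.
have Dm v : pairing (ray X v) m <= push_div D v := nef_support_le hX v nefD ampA SX cS mP.
pose c v := curve_relation C (section v).
have rel := curve_relation_rays C.
have cE u : curve_relation C u = c (collapse u) := relation_collapse rel u.
(* the linear function m pairs to zero with the relation c *)
have -> : inter D C = \sum_v c v * (push_div D v - pairing (ray X v) m).
  under [RHS]eq_bigr => v _ do rewrite mulrBr.
  rewrite sumrB -pairing_combl (relation_descends rel) pairing0l subr0.
  rewrite inter_relation sum_push_div.
  by apply: eq_bigr => u _; rewrite cE.
apply: sumr_ge0 => v _; have [vS|] := boolP (v \in saturated S).
  by rewrite mP // subrr mulr0.
(* some ray u over v is off the wall, so c v is the coefficient 0 or 1 of u *)
rewrite inE negb_forall => /existsP[u]; rewrite negb_imply => /andP[/eqP <- uS].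
apply: mulr_ge0; last by rewrite subr_ge0.
rewrite -cE; apply: curve_relation_ge0.
by apply: contraNN uS => uW; rewrite inE uW orbT.
Qed.

(** The lifted wall consists of the chosen rays over the wall of C together with
    all z_i other than the chosen one; this has the right dimension whether x is
    in the wall, one of the sides, or neither. *)
Lemma lift_curve (C : invariant_curve X) : smooth_complete X ->
  exists C' : invariant_curve XH,
    forall D, inter D C' = inter (push_div D) C.
Proof.
move=> hX; pose Z := new_rays :\ section x.
pose W := section @: wall C :|: Z.
have secZ v : section v \notin Z.
  rewrite in_setD1; apply/andP => -[vx /imsetP[i _ e]].
  have vE : v = x by rewrite -(sectionK v) e.
  by rewrite vE eqxx in vx.
have secW v : (section v \in W) = (v \in wall C).
  by rewrite in_setU (negbTE (secZ v)) orbF mem_imset //; exact: can_inj sectionK.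
have cZ : #|Z| = q.
  have := card_new_rays; rewrite (cardsD1 (section x)).
  by rewrite /Z section_x imset_f // add1n => -[].
have cW : #|W|.+1 = (n + q)%N.
  rewrite cardsU cZ card_imset; last exact: can_inj sectionK.
  have -> : section @: wall C :&: Z = set0.
    apply/setP => u; rewrite in_set0 in_setI; apply/negP => /andP[/imsetP[v _ ->]].
    by apply/negP.
  by rewrite cards0 subn0 -addSn (wall_dim C).
have notW u : u \notin W -> u = section (collapse u).
  case: u => [w|i] uW; first by rewrite section_old.
  apply/eqP; apply: contraNT uW => ux.
  by rewrite in_setU in_setD1 ux imset_f ?orbT.
have coneW a : a |: wall C \in cones X -> section a |: W \in cones XH.
  move=> aX; rewrite conesH //; apply: (cone_face hX) aX.
  apply/subsetP => v /saturatedP/(_ _ (sectionK v)).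
  by rewrite !in_setU1 secW (can_eq sectionK).
pose c u := curve_relation C (collapse u).
have c0 u : u \notin W -> u != section (side1 C) -> u != section (side2 C) -> c u = 0.
  move=> uW; have uE := notW u uW; rewrite uE !(can_eq sectionK) => u1 u2.
  by rewrite /c sectionK curve_relation0 // -secW -uE.
have rel : \sum_u c u *: ray XH u = 0.
  by rewrite (lift_relation (curve_relation C)) curve_relation_rays row_mx0.
have [|||||||||C' CE] := @curve_of_relation _ XH c W (section (side1 C)) (section (side2 C)) cW.
- by rewrite (can_eq sectionK) side_neq.
- by rewrite secW side1_notin.
- by rewrite secW side2_notin.
- exact/coneW/side1_cone.
- exact/coneW/side2_cone.
- by rewrite /c sectionK curve_relation_side1.
- by rewrite /c sectionK curve_relation_side2.
- exact: c0.
- exact: rel.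
exists C' => D; rewrite CE -sum_push_div; exact/esym/inter_relation.
Qed.

Lemma Pic_lift_Nef : smooth_projective X ->
  ([set Pic_lift E | E in Nef X] = Nef XH)%classic.
Proof.
move=> hX; apply/seteqP; split=> [_ [_ [D nefD <-] <-]|_ [D nefD <-]].
  exists (lift_div D); last by rewrite Pic_lift_cls.
  by apply: nef_of_push => // C; rewrite lift_divK; exact: nefD.
exists (cls (push_div D)); last by rewrite Pic_lift_cls push_divK.
exists (push_div D) => // C; have [C' <-] := lift_curve C hX.1.
exact: nefD.
Qed.

End HConstruction.

(** * Transport of the invariants tau *)

Section TauTransport.
Variables (R : realType) (n n' : nat) (X : toric n) (Y : toric n').
Variable f : {additive Pic X -> Pic Y}.
Hypotheses (f_inj : injective f) (f_nef : forall E, Nef X E -> Nef Y (f E)).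

Lemma sums_Z_image D : (sums_Z R D `<=` sums_Z R (f D))%classic.
Proof.
move=> s [r [a [E [a_gt0 E_neq0 E_nef -> ->]]]].
exists r, a, (f \o E); split=> // [i|i|]; first by rewrite raddf_eq0.
- exact: f_nef.
- by rewrite raddf_sum; apply: eq_bigr => i _; rewrite raddfMz.
Qed.

Lemma sums_Q_image D : (sums_Q R D `<=` sums_Q R (f D))%classic.
Proof.
move=> s [r [a [E [a_gt0 E_neq0 E_nef [N [b [N_gt0 bE DE]]] ->]]]].
exists r, a, (f \o E); split=> // [i|i|]; first by rewrite raddf_eq0.
- exact: f_nef.
- exists N, b; split=> //; rewrite -raddfMn DE raddf_sum.
  by apply: eq_bigr => i _; rewrite raddfMz.
Qed.

End TauTransport.

Lemma tau_isomorphism (R : realType) n n' (X : toric n) (Y : toric n')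
    (f : {additive Pic X -> Pic Y}) (g : {additive Pic Y -> Pic X}) D K :
  cancel f g -> cancel g f -> ([set f E | E in Nef X] = Nef Y)%classic ->
  tau R (f D) K = tau R D K.
Proof.
move=> fK gK fNef.
have f_nef E : Nef X E -> Nef Y (f E) by move=> nefE; rewrite -fNef; exists E.
have g_nef E : Nef Y E -> Nef X (g E).
  by rewrite -{1}fNef => -[E' nefE' <-]; rewrite fK.
have f_inj := can_inj fK; have g_inj := can_inj gK.
congr ereal_sup; case: K; apply/seteqP; split.
- by rewrite -[in X in (_ `<=` X)%classic](fK D); exact: sums_Z_image.
- exact: sums_Z_image.
- by rewrite -[in X in (_ `<=` X)%classic](fK D); exact: sums_Q_image.
- exact: sums_Q_image.
Qed.

Theorem proposition5p10 (n : nat) (X : toric n) (hX : smooth_projective X)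
    (x : rays X) (p : nat) (hp : (2 <= p)%N) :
  (exists (Phi : {additive Pic X -> Pic (H X x p)})
          (Phi_inv : Pic (H X x p) -> Pic X),
    [/\ cancel Phi Phi_inv /\ cancel Phi_inv Phi,
        forall (v : rays X) (hv : v != x), Phi (dcl v) = dcl (Hold p hv),
        forall i : 'I_p, Phi (dcl x) = dcl (Hz x i),
        [set Phi D | D in Nef X]%classic = Nef (H X x p)
      & Phi_inv (- canonical_class (H X x p)) =
          - canonical_class X + dcl x *+ p.-1])
  /\ (weak_fano (H X x p) ->
      forall (R : realType) (K : coeff),
        gongyo R (H X x p) K =
          tau R (- canonical_class X + dcl x *+ p.-1) K).
Proof.
case: p hp => [//|q] _; split=> [|_ R K].
  exists (@Pic_lift n X x q), (@Pic_push n X x q); split.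
  - by split; [exact: Pic_liftK|exact: Pic_pushK].
  - by move=> v hv; exact: (Pic_lift_dcl (Hold q.+1 hv)).
  - by move=> i; exact: (Pic_lift_dcl (Hz x i)).
  - exact: Pic_lift_Nef.
  - exact: Pic_push_anticanonical.
rewrite /gongyo -Pic_push_anticanonical -[in LHS](Pic_pushK (- _)).
exact: (tau_isomorphism R _ K (@Pic_liftK _ _ _ _) (@Pic_pushK _ _ _ _)
  (Pic_lift_Nef _ _ hX)).
Qed.
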